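(* Let $0<\beta<1$, $R_1,R_2\ge 1$, $P>0$, $\omega>0$, $\lambda>0$, $\mu>0$ be fixed, and let $S_{ad}=\{(\alpha,\gamma):0<\alpha<1,\ 0<\gamma<1\}$. For $(\alpha,\gamma)\in S_{ad}$, let $u_1^{\alpha,\gamma},u_2^{\alpha,\gamma}$ denote nonnegative and bounded solutions (in the mobile and immobile zones respectively) of the forward problem $$ \begin{cases} \beta R_1\,\partial_t^\alpha u_1=\dfrac{1}{P}\dfrac{\partial^2 u_1}{\partial x^2}-\dfrac{\partial u_1}{\partial x}-\omega(u_1-u_2)-\lambda u_1,\\[2mm] (1-\beta)R_2\,\partial_t^\gamma u_2=\omega(u_1-u_2)-\mu u_2, \end{cases} \qquad (x,t)\in(0,1)\times(0,\infty), $$ with $u_1(x,0)=u_2(x,0)=0$ for $0\le x\le 1$, and $u_1(0,t)=1$, $u_2(0,t)=0$, $\dfrac{\partial u_1}{\partial x}(1,t)=0$, $\dfrac{\partial u_2}{\partial x}(1,t)=0$ for $0<t<\infty$. Let $x_0\in\Omega=(0,1)$ be a fixed interior point. If $(\alpha_i,\gamma_i)\in S_{ad}$ for $i=1,2$ and $$u_1^{\alpha_1,\gamma_1}(x_0,t)=u_1^{\alpha_2,\gamma_2}(x_0,t)\quad\text{for all } t>0,$$ then $\alpha_1=\alpha_2$ and $\gamma_1=\gamma_2$.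
   Context: For $0<\alpha<1$ the Caputo fractional derivative in time is $$\partial_t^\alpha f(t)=\frac{1}{\Gamma(1-\alpha)}\int_0^t\frac{f'(\tau)}{(t-\tau)^\alpha}\,d\tau,$$ where $\Gamma$ is the Gamma function; it is applied in the $t$ variable for fixed $x$, with order $\alpha$ to $u_1$ and order $\gamma$ to $u_2$. Standing convention: the solutions are real-valued and regular enough that the Laplace transforms in $t\ge0$, $\hat f(s)=\int_0^\infty e^{-st}f(t)\,dt$, of the solutions and of their derivatives (including the fractional-order ones) can be performed, with $\mathcal L\{\partial_t^\alpha f;s\}=s^\alpha\hat f(s)-s^{\alpha-1}f(0)$. *)

(* Defs.v *)
From mathcomp Require Import all_boot all_order all_algebra.
From mathcomp Require Import all_classical all_reals all_analysis.
Set Implicit Arguments.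
Unset Strict Implicit.
Unset Printing Implicit Defensive.
Import Order.TTheory GRing.Theory Num.Theory.
Import numFieldNormedType.Exports.
Local Open Scope classical_set_scope.
Local Open Scope ring_scope.

(* Euler's Gamma function, for z > 0. *)
Definition Gamma (R : realType) (z : R) : R :=
  \int[@lebesgue_measure R]_(t in `]0, +oo[) (t `^ (z - 1) * expR (- t)).

Definition caputo_integrand (R : realType) (a : R) (f : R -> R) (t : R) : R -> R :=
  fun tau => derive1 f tau / (t - tau) `^ a.

(* [caputo] is a total function; it is only meaningful under
   [caputo_differentiable]. *)
Definition caputo (R : realType) (a : R) (f : R -> R) (t : R) : R :=
  (Gamma (1 - a))^-1 *
  \int[@lebesgue_measure R]_(tau in `]0, t[) caputo_integrand a f t tau.

Definition caputo_differentiable (R : realType) (a : R) (f : R -> R) : Prop :=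
  [/\ f t @[t --> 0^'+] --> f 0,
      forall t, 0 < t -> derivable f t 1 &
      forall t, 0 < t -> (@lebesgue_measure R).-integrable `]0, t[
                           (EFin \o caputo_integrand a f t)].

Definition laplace (R : realType) (f : R -> R) (s : R) : R :=
  \int[@lebesgue_measure R]_(t in `[0, +oo[) (expR (- (s * t)) * f t).

Definition laplaceable (R : realType) (f : R -> R) (s : R) : Prop :=
  (@lebesgue_measure R).-integrable `[0, +oo[
    (fun t => (expR (- (s * t)) * f t)%:E).

(* The Laplace integrals of the functions t |-> h x t, x in D, converge
   absolutely with a common integrable majorant. *)
Definition laplaceable_on (R : realType) (D : set R) (h : R -> R -> R) (s : R)
    : Prop :=
  exists2 g : R -> R,
    (@lebesgue_measure R).-integrable `[0, +oo[ (EFin \o g) &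
    forall x t, D x -> 0 < t -> `|expR (- (s * t)) * h x t| <= g t.

Definition caputo_laplace_rule (R : realType) (a : R) (f : R -> R) (s : R)
    : Prop :=
  laplace (caputo a f) s = s `^ a * laplace f s - s `^ (a - 1) * f 0.

Definition is_left_derivative (R : realType) (f : R -> R) (x l : R) : Prop :=
  h^-1 * (f (x + h) - f x) @[h --> 0^'-] --> l.

Definition dx (R : realType) (u : R -> R -> R) (x t : R) : R := derive1 (u ^~ t) x.

Definition dxx (R : realType) (u : R -> R -> R) (x t : R) : R := dx (dx u) x t.

(* The Laplace transform in t can be performed, for all large s, on the
   solution (u1, u2) and on all derivatives occurring in the system.  The
   majorants for the x-derivatives are only required away from x = 0, where the
   data u1(x, 0) = 0 and u1(0, t) = 1 are incompatible at the corner. *)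
Definition laplace_regular (R : realType) (alpha gamma : R) (u1 u2 : R -> R -> R)
    : Prop :=
  \forall s \near +oo,
    (forall x, 0 < x < 1 ->
       [/\ laplaceable (u1 x) s, laplaceable (caputo alpha (u1 x)) s &
           caputo_laplace_rule alpha (u1 x) s]) /\
    (forall x, 0 < x < 1 ->
       [/\ laplaceable (u2 x) s, laplaceable (caputo gamma (u2 x)) s &
           caputo_laplace_rule gamma (u2 x) s]) /\
    (forall a, 0 < a < 1 ->
       laplaceable_on `[a, 1[ (dx u1) s /\ laplaceable_on `[a, 1[ (dxx u1) s).

(* u1 and u2 are functions of (x, t); only their values on [0,1] x [0,+oo[
   matter.  No continuity of u2 at x = 0 is imposed: the second equation inside
   the domain forces the limit of u2(x, t) as x -> 0 to differ from the
   prescribed value u2(0, t) = 0, so continuity would exclude every solution. *)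
Record forward_solution (R : realType)
    (beta R1 R2 P omega lambda mu alpha gamma : R) (u1 u2 : R -> R -> R)
    : Prop := ForwardSolution {
  fs_nonneg : forall x t, 0 <= x <= 1 -> 0 <= t -> 0 <= u1 x t /\ 0 <= u2 x t;
  fs_bounded : exists M : R, forall x t, 0 <= x <= 1 -> 0 <= t ->
    `|u1 x t| <= M /\ `|u2 x t| <= M;
  fs_caputo : forall x, 0 < x < 1 ->
    caputo_differentiable alpha (u1 x) /\ caputo_differentiable gamma (u2 x);
  fs_dx : forall t, 0 < t -> derivable_oo_LRcontinuous (u1 ^~ t) 0 1;
  fs_dxx : forall x t, 0 < x < 1 -> 0 < t -> derivable (dx u1 ^~ t) x 1;
  fs_laplace : laplace_regular alpha gamma u1 u2;
  fs_mobile : forall x t, 0 < x < 1 -> 0 < t ->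
    beta * R1 * caputo alpha (u1 x) t =
      P^-1 * dxx u1 x t - dx u1 x t - omega * (u1 x t - u2 x t)
      - lambda * u1 x t;
  fs_immobile : forall x t, 0 < x < 1 -> 0 < t ->
    (1 - beta) * R2 * caputo gamma (u2 x) t =
      omega * (u1 x t - u2 x t) - mu * u2 x t;
  fs_initial : forall x, 0 <= x <= 1 -> u1 x 0 = 0 /\ u2 x 0 = 0;
  fs_inlet : forall t, 0 < t -> u1 0 t = 1 /\ u2 0 t = 0;
  fs_outlet : forall t, 0 < t ->
    is_left_derivative (u1 ^~ t) 1 0 /\ is_left_derivative (u2 ^~ t) 1 0
}.

(* Main.v *)
(* The Laplace transforms U, V of u1, u2 in t satisfy, for all large s,
   U'' - P U' = P K(s) U on (0, 1), U(0) = 1/s, U'(1) = 0, where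
   K(s) = beta R1 s^alpha + omega + lambda
          - omega^2 / ((1 - beta) R2 s^gamma + omega + mu) > 0.
   This boundary value problem is solved explicitly, and a Wronskian argument
   shows that U(x0) is strictly decreasing in K(s).  Equal observations at x0
   therefore give equal functions K for all large s; their leading term
   determines alpha, and then the remaining term determines gamma. *)
Require Import Defs.
From mathcomp Require Import all_boot all_order all_algebra.
From mathcomp Require Import all_classical all_reals all_analysis.
From mathcomp Require Import measurable_realfun ring lra.
Set Implicit Arguments.
Unset Strict Implicit.
Unset Printing Implicit Defensive.
Import Order.TTheory GRing.Theory Num.Theory.
Import numFieldNormedType.Exports.
Local Open Scope classical_set_scope.
Local Open Scope ring_scope.

(** * Second-order linear equations with constant coefficients on an open interval *)

Section ode.
Context {R : realType}.
Implicit Types (a b r x y : R) (f U V : R -> R).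

Lemma is_derive_expR_scale r x :
  is_derive x 1 (fun y => expR (r * y)) (r * expR (r * x)).
Proof.
by apply: is_derive_eq; rewrite /GRing.scale/=; ring.
Qed.

Lemma is_derive0_cst_itvoo a b f :
  (forall x, a < x < b -> is_derive x 1 f 0) ->
  forall x y, a < x < b -> a < y < b -> f x = f y.
Proof.
move=> f0; suff lt_cst x y : a < x < b -> a < y < b -> x < y -> f x = f y.
  move=> x y xab yab; have [xy|yx|->//] := ltgtP x y; first exact: lt_cst.
  by apply/esym/lt_cst.
move=> /andP[ax xb] /andP[ay yb] xy.
have fxy z : z \in `[x, y]%R -> is_derive z 1 f 0.
  rewrite in_itv/= => /andP[xz zy]; apply: f0.
  by rewrite (lt_le_trans ax)// (le_lt_trans zy).
have dfxy z : z \in `]x, y[%R -> is_derive z 1 f ((fun=> 0) z).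
  by move=> zxy; apply: fxy; exact: subset_itv_oo_cc.
have cf : {within `[x, y], continuous f}.
  by apply: derivable_within_continuous => z /fxy /@ex_derive.
have [c _] := MVT xy dfxy cf.
by rewrite mul0r => /eqP; rewrite subr_eq0 => /eqP ->.
Qed.

(* The operator D^2 - (p + m) D + p m factors as (D - m)(D - p), so
   (U' - p U) e^(-m x) is constant. *)
Lemma second_order_factor a b p m U V :
  (forall x, a < x < b -> is_derive x 1 U (V x)) ->
  (forall x, a < x < b -> is_derive x 1 V ((p + m) * V x - p * m * U x)) ->
  exists C, forall x, a < x < b -> V x - p * U x = C * expR (m * x).
Proof.
move=> dU dV.
have [ab|ba] := ltP a b; last first.
  by exists 0 => x /andP[ax xb]; have := lt_trans ax xb; rewrite ltNge ba.
pose G x := (V x - p * U x) * expR (- m * x).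
have G0 x : a < x < b -> is_derive x 1 G 0.
  move=> xab; have ? := dU x xab; have ? := dV x xab.
  have ? := is_derive_expR_scale (- m) x.
  rewrite /G; apply: is_derive_eq.
  rewrite /GRing.scale/=; ring.
have cab : a < (a + b) / 2 < b by apply/andP; split; lra.
exists (G ((a + b) / 2)) => x xab.
rewrite (is_derive0_cst_itvoo G0 cab xab) /G -mulrA -expRD -mulrDl addNr mul0r.
by rewrite expR0 mulr1.
Qed.

(** The two orders of factorisation give U' - p U = C e^(m x) and U' - m U = D e^(p x); subtracting
    eliminates U' and leaves (p - m) U. *)
Lemma second_order_solution a b p m U V : p != m ->
  (forall x, a < x < b -> is_derive x 1 U (V x)) ->
  (forall x, a < x < b -> is_derive x 1 V ((p + m) * V x - p * m * U x)) ->
  exists A B, forall x, a < x < b -> U x = A * expR (p * x) + B * expR (m * x).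
Proof.
move=> pm dU dV.
have [C HC] := second_order_factor dU dV.
have dV' x : a < x < b -> is_derive x 1 V ((m + p) * V x - m * p * U x).
  by rewrite [m + p]addrC [m * p]mulrC; exact: dV.
have [D HD] := second_order_factor dU dV'.
exists (D / (p - m)), (- C / (p - m)) => x xab.
have pm0 : p - m != 0 by rewrite subr_eq0.
apply: (mulfI pm0); transitivity (D * expR (p * x) - C * expR (m * x)).
  by rewrite -(HD x xab) -(HC x xab); ring.
by field.
Qed.

End ode.

(** * Explicit solutions with zero slope at 1, and their comparison *)

Section profile.
Context {R : realType}.
Implicit Types (p m x : R).

(** A solution of f'' - (p + m) f' + p m f = 0 with f'(1) = 0, scaled so that it is positive
    everywhere when m < 0 < p. *)
Definition profile p m x : R := p * expR (p + m * x) - m * expR (m + p * x).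

Definition profile_slope p m x : R :=
  p * m * (expR (p + m * x) - expR (m + p * x)).

Lemma is_derive_profile p m x :
  is_derive x 1 (profile p m) (profile_slope p m x).
Proof.
rewrite /profile /profile_slope; apply: is_derive_eq.
rewrite /GRing.scale/=; ring.
Qed.

Lemma is_derive_profile_slope p m x :
  is_derive x 1 (profile_slope p m)
    ((p + m) * profile_slope p m x - p * m * profile p m x).
Proof.
rewrite /profile /profile_slope; apply: is_derive_eq.
rewrite /GRing.scale/=; ring.
Qed.

Lemma profile_slope1 p m : profile_slope p m 1 = 0.
Proof. by rewrite /profile_slope !mulr1 [m + p]addrC subrr mulr0. Qed.

Lemma profile_gt0 p m x : 0 < p -> m < 0 -> 0 < profile p m x.
Proof.
by move=> p0 m0; rewrite subr_gt0 (@lt_trans _ _ 0) ?nmulr_rlt0 ?mulr_gt0 ?expR_gt0.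
Qed.

(** The equation assumed on [A] and [B] says that the slope at 1 vanishes. It determines the sum of
    exponentials up to a factor, which is read off from the value [A + B] at 0. *)
Lemma exp_sum_eq_profile p m A B x : 0 < p -> m < 0 ->
  A * (p * expR p) + B * (m * expR m) = 0 ->
  A * expR (p * x) + B * expR (m * x) = (A + B) * (profile p m x / profile p m 0).
Proof.
move=> p0 m0 AB0; rewrite mulrA.
have d0 : profile p m 0 != 0 by rewrite gt_eqF// profile_gt0.
apply: (mulIf d0); rewrite divfK// /profile !mulr0 !addr0 !expRD.
apply/eqP; rewrite -subr_eq0; apply/eqP.
(* After clearing the denominator, the two sides differ by the slope at 1 times e^(p x) - e^(m
   x). *)
transitivity ((A * (p * expR p) + B * (m * expR m)) *
  (expR (p * x) - expR (m * x))); last by rewrite AB0 mul0r.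
ring.
Qed.

Lemma decreasing_of_derive_lt0 (a b : R) (f df : R -> R) : a < b ->
  (forall x, a <= x <= b -> is_derive x 1 f (df x)) ->
  (forall x, a < x < b -> df x < 0) -> f b < f a.
Proof.
move=> ab fd df0.
have dab z : z \in `]a, b[%R -> is_derive z 1 f (df z).
  by rewrite in_itv/= => /andP[az zb]; apply: fd; rewrite !ltW.
have cf : {within `[a, b], continuous f}.
  by apply: derivable_within_continuous => z; rewrite in_itv/= => /fd /@ex_derive.
have [c cab e] := MVT ab dab cf.
by rewrite -subr_lt0 e nmulr_rlt0 ?subr_gt0//; apply: df0; rewrite in_itv in cab.
Qed.

(* Wronskian argument: e^(- P x) (f1' f2 - f1 f2') vanishes at 1 and has
   derivative (p2 m2 - p1 m1) e^(- P x) f1 f2 < 0, hence f1 / f2 increases. *)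
Lemma profile_ratio_lt p1 m1 p2 m2 x :
  0 < p1 -> m1 < 0 -> 0 < p2 -> m2 < 0 -> p1 + m1 = p2 + m2 ->
  p2 * m2 < p1 * m1 -> 0 < x < 1 ->
  profile p2 m2 x / profile p2 m2 0 < profile p1 m1 x / profile p1 m1 0.
Proof.
move=> p10 m10 p20 m20 eP q12 /andP[x0 x1].
set f1 := profile p1 m1; set f2 := profile p2 m2.
pose s1 := profile_slope p1 m1; pose s2 := profile_slope p2 m2.
have f1p (y : R) : 0 < f1 y by exact: profile_gt0.
have f2p (y : R) : 0 < f2 y by exact: profile_gt0.
pose W (y : R) := expR (- (p1 + m1) * y) * (s1 y * f2 y - f1 y * s2 y).
pose dW (y : R) := expR (- (p1 + m1) * y) * ((p2 * m2 - p1 * m1) * (f1 y * f2 y)).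
have Wd (y : R) : is_derive y 1 W (dW y).
  have ? := is_derive_profile p1 m1 y; have ? := is_derive_profile p2 m2 y.
  have ? := is_derive_profile_slope p1 m1 y.
  have ? := is_derive_profile_slope p2 m2 y.
  have ? := is_derive_expR_scale (- (p1 + m1)) y.
  rewrite /W; apply: is_derive_eq; rewrite /dW /GRing.scale/= -eP -/f1 -/f2 -/s1 -/s2.
  ring.
have W0 (y : R) : y < 1 -> 0 < W y.
  move=> y1; have -> : 0 = W 1 by rewrite /W /s1 /s2 !profile_slope1; ring.
  apply: (@decreasing_of_derive_lt0 y 1 W dW) => // z _.
  by rewrite pmulr_rlt0 ?expR_gt0// nmulr_rlt0 ?mulr_gt0// subr_lt0.
(* The ratio is negated to fit [decreasing_of_derive_lt0]. *)
have Nd (y : R) : 0 <= y <= x ->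
    is_derive y 1 (fun y => - (f1 y / f2 y))
      (- ((s1 y * f2 y - f1 y * s2 y) / f2 y ^+ 2)).
  move=> _; have ? := is_derive_profile p1 m1 y.
  have ? := is_derive_profile p2 m2 y.
  have f2n : f2 y != 0 by rewrite gt_eqF.
  have ? : is_derive y 1 (fun z => (f2 z)^-1) (- f2 y ^- 2 *: s2 y) by exact: is_deriveV.
  apply: is_derive_eq.
  rewrite /GRing.scale/= -/f1 -/f2 -/s1 -/s2.
  by field.
have Ndlt0 (y : R) : 0 < y < x ->
    - ((s1 y * f2 y - f1 y * s2 y) / f2 y ^+ 2) < 0.
  move=> /andP[_ yx]; rewrite oppr_lt0 divr_gt0 ?exprn_gt0//.
  by have := W0 y (lt_trans yx x1); rewrite /W pmulr_rgt0 ?expR_gt0.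
have := decreasing_of_derive_lt0 x0 Nd Ndlt0; rewrite ltrN2.
rewrite !ltr_pdivrMr// ![_ / _ * _]mulrAC !ltr_pdivlMr//.
by rewrite [f2 x * _]mulrC.
Qed.

End profile.

(** * The boundary value problem with data given as limits *)

Section boundary_value_problem.
Context {R : realType}.

(** Dominated convergence and measurability of limits work along sequences, so derivatives are
    needed as sequential limits. *)
Lemma is_derive_cvg_seq (f : R -> R) (x l : R) (h : nat -> R) :
  is_derive x 1 f l -> (forall n, h n != 0) -> h n @[n --> \oo] --> 0 ->
  (f (x + h n) - f x) / h n @[n --> \oo] --> l.
Proof.
move=> [dfx <-] h0 hcvg; move: dfx => /cvg_ex[/= l' fl'].
have -> : 'D_1 f x = l' by apply/cvg_lim.
move: fl' => /cvgr_dnbhsP /(_ h (conj h0 hcvg)).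
apply: cvg_trans; apply: near_eq_cvg; apply: nearW => n /=.
by rewrite scaler1 [h n + x]addrC [RHS]mulrC.
Qed.

(** Inside (0, 1), [U] coincides with a sum of exponentials [f] that is smooth on the whole line.
    The boundary data of [U], known only as limits along [h], therefore become f(0) = c and f'(1) =
    0. *)
Lemma boundary_value_problem_solution (p m c u1 : R) (U V : R -> R) (h : nat -> R) :
  0 < p -> m < 0 ->
  (forall x : R, 0 < x < 1 -> is_derive x 1 U (V x)) ->
  (forall x : R, 0 < x < 1 -> is_derive x 1 V ((p + m) * V x - p * m * U x)) ->
  (forall n, 0 < h n < 1) -> h n @[n --> \oo] --> 0 ->
  U (h n) @[n --> \oo] --> c ->
  (u1 - U (1 - h n)) / h n @[n --> \oo] --> 0 ->
  forall x : R, 0 < x < 1 -> U x = c * (profile p m x / profile p m 0).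
Proof.
move=> p0 m0 dU dV h01 hcvg Uc Uu1.
have pm : p != m by rewrite gt_eqF// (lt_trans m0).
have [A [B UE]] := second_order_solution pm dU dV.
pose f (x : R) := A * expR (p * x) + B * expR (m * x).
have df (x : R) : is_derive x 1 f (A * (p * expR (p * x)) + B * (m * expR (m * x))).
  have ? := is_derive_expR_scale p x; have ? := is_derive_expR_scale m x.
  by rewrite /f; apply: is_derive_eq.
have cf (x : R) : {for x, continuous f}.
  by apply: differentiable_continuous; apply/derivable1_diffP; have [] := df x.
have ABc : A + B = c.
  have -> : A + B = f 0 by rewrite /f !mulr0 expR0 !mulr1.
  apply: (@norm_cvg_unique _ _ (U (h n) @[n --> \oo])) => //.
  have : f (h n) @[n --> \oo] --> f 0 by apply: (continuous_cvg _ (cf 0)).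
  apply: cvg_trans; apply: near_eq_cvg; apply: nearW => n.
  by rewrite UE.
have h10 n : h n != 0 by case/andP: (h01 n) => /gt_eqF ->.
have U1 n : U (1 - h n) = f (1 - h n).
  by rewrite UE//; have := h01 n; lra.
have cvg1h : 1 - h n @[n --> \oo] --> (1 : R).
  by rewrite -[X in _ --> X]subr0; apply: cvgB => //; exact: cvg_cst.
(* The difference quotients converge, so their numerators tend to 0: U(1 - h n) tends to [u1], and
   also to f(1). *)
have u1f : u1 = f 1.
  apply: (@norm_cvg_unique _ _ (f (1 - h n) @[n --> \oo])) => //; last first.
    exact: (continuous_cvg _ (cf 1)).
  have : u1 - h n * ((u1 - U (1 - h n)) / h n) @[n --> \oo] --> u1 - 0 * 0.
    by apply: cvgB; [exact: cvg_cst|exact: cvgM].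
  rewrite mulr0 subr0.
  apply: cvg_trans; apply: near_eq_cvg; apply: nearW => n.
  by rewrite mulrC divfK// U1 subKr.
move=> x x01; rewrite UE// -ABc; apply: exp_sum_eq_profile => //.
have h10' n : - h n != 0 by rewrite oppr_eq0.
have hcvg' : - h n @[n --> \oo] --> 0 by rewrite -oppr0; exact: cvgN.
(* The quotients of [f] at 1 along - h n tend both to f'(1) and to 0, which is the required relation
   between [A] and [B]. *)
have := is_derive_cvg_seq (df 1) h10' hcvg'; rewrite !mulr1 => df1.
apply: (@norm_cvg_unique _ _ ((f (1 - h n) - f 1) / - h n @[n --> \oo])) => //.
apply: cvg_trans Uu1; apply: near_eq_cvg; apply: nearW => n.
by rewrite U1 u1f invrN mulrN -mulNr opprB.
Qed.

(** Since q > 0, the square root [D] of the discriminant exceeds [P], which gives the roots opposite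
    signs. *)
Lemma quadratic_roots (P q : R) : 0 < P -> 0 < q ->
  exists p m, [/\ 0 < p, m < 0, p + m = P & p * m = - q].
Proof.
move=> P0 q0; pose D := Num.sqrt (P ^+ 2 + 4 * q).
have DE : D ^+ 2 = P ^+ 2 + 4 * q by rewrite sqr_sqrtr//; nra.
have D0 : 0 <= D by exact: sqrtr_ge0.
exists ((P + D) / 2), ((P - D) / 2); split; first lra.
- have PD : P < D.
    by rewrite -(@ltr_pXn2r _ 2)// ?nnegrE ?(ltW P0)// DE; lra.
  by lra.
- lra.
- by transitivity ((P ^+ 2 - D ^+ 2) / 4); [field|rewrite DE; field].
Qed.

End boundary_value_problem.

(** * Dominated convergence, exponential integrals and differentiation under the integral *)

Section measure.
Context {R : realType}.
Local Notation mu := (@lebesgue_measure R).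
Local Notation B := (`]0%R, +oo[%classic : set R).

Let mB : @measurable _ (measurableTypeR R) B.
Proof. exact: measurable_itv. Qed.

Lemma Rintegral_dominated_cvg d (T : measurableType d) (nu : {measure set T -> \bar R})
    (D : set T) (f_ : nat -> T -> R) (f g : T -> R) :
  measurable D -> (forall n, measurable_fun D (f_ n)) ->
  (forall t, D t -> f_ n t @[n --> \oo] --> f t) ->
  nu.-integrable D (EFin \o g) ->
  (forall n t, D t -> `|f_ n t| <= g t) ->
  nu.-integrable D (EFin \o f) /\
  \int[nu]_(t in D) f_ n t @[n --> \oo] --> \int[nu]_(t in D) f t.
Proof.
move=> mD mf cf ig fg.
have mf' n : measurable_fun D (fun t => (f_ n t)%:E) by exact/measurable_EFinP.
have mfl : measurable_fun D (fun t => (f t)%:E).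
  apply/measurable_EFinP; exact: measurable_fun_cvg mf cf.
have cf' : {ae nu, forall t, D t -> (f_ n t)%:E @[n --> \oo] --> (f t)%:E}.
  by apply: aeW => t Dt; apply: cvg_EFin; [exact: nearW|exact: cf].
have fg' : {ae nu, forall t n, D t -> (`|(f_ n t)%:E| <= (EFin \o g) t)%E}.
  by apply: aeW => t n Dt; rewrite lee_fin; exact: fg.
have [intf _ cvgint] := dominated_convergence mD mf' mfl cf' ig fg'.
split => //; apply: fine_cvg; rewrite fineK//; exact: integrable_fin_num.
Qed.

Lemma integrable_expR_scale (s : R) : 0 < s ->
  mu.-integrable B (fun t => (expR (- (s * t)))%:E).
Proof.
move=> s0.
have := integrableS measurableT mB (@subsetT _ B) (integrable_exponential_pdf s0).
move=> /(integrableZl mB s^-1).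
apply: eq_integrable => // t; rewrite inE/= in_itv/= andbT => t0.
by rewrite exponential_pdfE ?(ltW t0)// -EFinM mulrA mulVf ?gt_eqF// mul1r mulNr.
Qed.

Lemma Rintegral_expR_scale (s : R) : 0 < s ->
  \int[mu]_(t in B) expR (- (s * t)) = s^-1.
Proof.
move=> s0; apply: (mulfI (lt0r_neq0 s0)); rewrite mulfV ?lt0r_neq0//.
transitivity (\int[mu]_t exponential_pdf s t); last first.
  by rewrite /Rintegral integral_exponential_pdf.
rewrite -RintegralZl//; last exact: integrable_expR_scale.
rewrite Rintegral_itv_obnd_cbnd; last first.
  exact: (integrableZl mB s (integrable_expR_scale s0)).
rewrite /exponential_pdf -Rintegral_mkcond.
by apply: eq_Rintegral => t _; rewrite mulNr.
Qed.

Lemma RintegralD_scale d (T : measurableType d) (nu : {measure set T -> \bar R})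
    (D : set T) (a b : R) (f g : T -> R) : measurable D ->
  nu.-integrable D (EFin \o f) -> nu.-integrable D (EFin \o g) ->
  nu.-integrable D (fun t => (a * f t + b * g t)%:E) /\
  \int[nu]_(t in D) (a * f t + b * g t) =
    a * \int[nu]_(t in D) f t + b * \int[nu]_(t in D) g t.
Proof.
move=> mD intf intg.
have intaf : nu.-integrable D (EFin \o (fun t => a * f t)).
  exact: (integrableZl mD a intf).
have intbg : nu.-integrable D (EFin \o (fun t => b * g t)).
  exact: (integrableZl mD b intg).
split; first exact: (integrableD mD intaf intbg).
by rewrite RintegralD// !RintegralZl.
Qed.

(** The shifted sequence is 1/(n + 2): it starts at 1/2, so it and its reflection about 1/2 stay
    inside the open interval where the equations hold. *)
Lemma harmonicS_itv n : 0 < (harmonic n.+1 : R) < 1.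
Proof. by rewrite harmonic_gt0 /= invf_lt1 ?ltr1n. Qed.

Lemma cvg_harmonicS : harmonic n.+1 @[n --> \oo] --> (0 : R).
Proof. by rewrite (cvg_shiftS (@harmonic R)); exact: cvg_harmonic. Qed.

(** The majorant [g] dominates the derivative, whose measurability comes from its being a pointwise
    limit of measurable difference quotients. *)
Lemma is_derive_Rintegral d (T : measurableType d) (nu : {measure set T -> \bar R})
    (D : set T) (f : R -> T -> R) (g : T -> R) (a b : R) : measurable D ->
  (forall x, a < x < b -> nu.-integrable D (EFin \o f x)) ->
  (forall x t, a < x < b -> D t -> derivable (f ^~ t) x 1) ->
  nu.-integrable D (EFin \o g) ->
  (forall x t, a < x < b -> D t -> `|derive1 (f ^~ t) x| <= g t) ->
  forall x, a < x < b ->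
    nu.-integrable D (fun t => (derive1 (f ^~ t) x)%:E) /\
    is_derive x 1 (fun y => \int[nu]_(t in D) f y t)
      (\int[nu]_(t in D) derive1 (f ^~ t) x).
Proof.
move=> mD intf df intg fg x xab.
have Ix : `]a, b[%classic x by rewrite /= in_itv/=.
have intf' y : `]a, b[%classic y -> nu.-integrable D (EFin \o f y).
  by rewrite /= in_itv/=; exact: intf.
have df' y t : `]a, b[%classic y -> D t -> derivable (f ^~ t) y 1.
  by rewrite /= in_itv/=; exact: df.
(* [g] may be negative outside [D]; its absolute value is a majorant that is nonnegative
   everywhere. *)
have intng : nu.-integrable D (EFin \o (fun t => `|g t|)).
  exact: (integrable_abse intg).
have fg' y t : `]a, b[%classic y -> D t -> `|partial1of2 f y t| <= `|g t|.
  rewrite /= in_itv/= => yab Dt; apply: le_trans (ler_norm _).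
  exact: fg.
have ng0 t : 0 <= `|g t| by exact: normr_ge0.
split; last first.
  apply: DeriveDef.
    exact: (derivable_under_integral mD Ix intf' df' ng0 intng fg').
  by rewrite -derive1E (differentiation_under_integral mD Ix intf' df' ng0 intng fg').
apply: (@le_integrable _ _ _ _ _ mD _ (EFin \o g)) => //; last first.
  by move=> t Dt /=; rewrite lee_fin (le_trans (fg _ _ _ _))// ler_norm.
case/andP: (xab) => ax xb.
(* The factor [b - x] keeps [x + h n] below [b]. *)
pose h n := (b - x) * harmonic n.+1.
have bx : 0 < b - x by rewrite subr_gt0.
have h0 n : 0 < h n by apply: mulr_gt0 => //; exact: harmonic_gt0.
have hxab n : a < x + h n < b.
  rewrite (lt_le_trans ax) ?lerDl ?(ltW (h0 n))//=.
  rewrite -ltrBrDl /h -[ltRHS]mulr1 ltr_pM2l//.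
  by case/andP: (harmonicS_itv n).
have hcvg : h n @[n --> \oo] --> 0.
  rewrite -[X in _ --> X](mulr0 (b - x)); apply: cvgM; first exact: cvg_cst.
  exact: cvg_harmonicS.
have hn0 n : h n != 0 by rewrite gt_eqF.
apply/measurable_EFinP.
apply: (@measurable_fun_cvg _ _ _ _ (fun n t => (f (x + h n) t - f x t) / h n)).
  move=> n; apply: measurable_funM => //; apply: measurable_funB.
    by have /integrableP[/measurable_EFinP] := intf _ (hxab n).
  by have /integrableP[/measurable_EFinP] := intf _ xab.
move=> t Dt; apply: (@is_derive_cvg_seq _ (f ^~ t)) => //.
by rewrite derive1E; apply/derivableP; exact: df.
Qed.

End measure.

(** * Laplace integrals over the open half-line, where the equations hold *)

Section laplace_halfline.
Context {R : realType}.
Local Notation mu := (@lebesgue_measure R).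
Local Notation B := (`]0%R, +oo[%classic : set R).

Let mB : @measurable _ (measurableTypeR R) B.
Proof. exact: measurable_itv. Qed.

Let mBc : @measurable _ (measurableTypeR R) (`[0%R, +oo[%classic : set R).
Proof. exact: measurable_itv. Qed.

Let sB : B `<=` (`[0%R, +oo[%classic : set R).
Proof. by apply: subset_itvr; rewrite bnd_simp. Qed.

Lemma laplaceable_itv_oo (f : R -> R) s : laplaceable f s ->
  mu.-integrable B (EFin \o (fun t => expR (- (s * t)) * f t)).
Proof. exact: integrableS. Qed.

Lemma laplace_itv_oo (f : R -> R) s : laplaceable f s ->
  laplace f s = \int[mu]_(t in B) (expR (- (s * t)) * f t).
Proof.
by move=> lf; rewrite /laplace Rintegral_itv_obnd_cbnd//; exact: laplaceable_itv_oo.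
Qed.

End laplace_halfline.

(* Coefficient multiplying P U in the transformed mobile equation
   U'' - P U' = P (symbol s) U, once the immobile transform
   V = omega U / ((1 - beta) R2 s^gamma + omega + mu) is eliminated. *)
Definition symbol (R : realType) (beta R1 R2 omega lambda mu alpha gamma s : R) : R :=
  beta * R1 * s `^ alpha + omega + lambda
  - omega ^+ 2 / ((1 - beta) * R2 * s `^ gamma + omega + mu).

(** * The boundary value problem satisfied by the Laplace transforms *)

Section transformed_solution.
Context {R : realType}.
Variables (beta R1 R2 P omega lambda mu alpha gamma s : R) (u1 u2 : R -> R -> R).
Hypotheses (hbeta : 0 < beta < 1) (hR2 : 1 <= R2) (hP : 0 < P).
Hypotheses (homega : 0 < omega) (hmu : 0 < mu) (s0 : 0 < s).
Hypothesis hu : forward_solution beta R1 R2 P omega lambda mu alpha gamma u1 u2.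
Hypothesis hu1 : forall x : R, 0 < x < 1 ->
  [/\ laplaceable (u1 x) s, laplaceable (caputo alpha (u1 x)) s &
      caputo_laplace_rule alpha (u1 x) s].
Hypothesis hu2 : forall x : R, 0 < x < 1 ->
  [/\ laplaceable (u2 x) s, laplaceable (caputo gamma (u2 x)) s &
      caputo_laplace_rule gamma (u2 x) s].
Hypothesis hdx : forall a : R, 0 < a < 1 ->
  laplaceable_on `[a, 1[ (dx u1) s /\ laplaceable_on `[a, 1[ (dxx u1) s.

Local Notation leb := (@lebesgue_measure R).
Local Notation B := (`]0%R, +oo[%classic : set R).
Local Notation L f := (\int[leb]_(t in B) (expR (- (s * t)) * f t)).
Local Notation k := (symbol beta R1 R2 omega lambda mu alpha gamma s).

Let mB : @measurable _ (measurableTypeR R) B.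
Proof. exact: measurable_itv. Qed.

Let B_gt0 t : B t -> 0 < t.
Proof. by rewrite /= in_itv/= andbT. Qed.

(** The immobile equation is integrated against e^(-s t); as u2(x, 0) = 0, the Caputo rule leaves
    only s^gamma times the transform. *)
Lemma immobile_transform (x : R) : 0 < x < 1 ->
  ((1 - beta) * R2 * s `^ gamma + omega + mu) * L (u2 x) = omega * L (u1 x).
Proof.
move=> x01; have [l1 _ _] := hu1 x01; have [l2 lc r] := hu2 x01.
have xc : 0 <= x <= 1 by case/andP: x01 => ? ?; rewrite !ltW.
have [_ u20] := fs_initial hu xc.
move: r; rewrite /caputo_laplace_rule u20 mulr0 subr0.
rewrite (laplace_itv_oo lc) (laplace_itv_oo l2) => r.
have i1 := laplaceable_itv_oo l1; have i2 := laplaceable_itv_oo l2.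
have ic := laplaceable_itv_oo lc.
have [_ ] := RintegralD_scale omega (- (omega + mu)) mB i1 i2.
have -> : \int[leb]_(t in B) (omega * (expR (- (s * t)) * u1 x t)
    + - (omega + mu) * (expR (- (s * t)) * u2 x t))
  = (1 - beta) * R2 * L (caputo gamma (u2 x)).
  rewrite -RintegralZl//; apply: eq_Rintegral => t; rewrite inE => /B_gt0 t0.
  by rewrite [RHS]mulrCA (fs_immobile hu x01 t0); ring.
by rewrite r => e; apply/eqP; rewrite -subr_eq0; apply/eqP; lra.
Qed.

(** [P] times the mobile equation is solved for the second x-derivative and transformed;
    [immobile_transform] then eliminates [u2], which produces the symbol. *)
Lemma mobile_transform (x : R) : 0 < x < 1 ->
  leb.-integrable B (EFin \o (fun t => expR (- (s * t)) * dx u1 x t)) ->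
  L (dxx u1 x) = P * L (dx u1 x) + P * k * L (u1 x).
Proof.
move=> x01 id; have [l1 lc r] := hu1 x01; have [l2 _ _] := hu2 x01.
have xc : 0 <= x <= 1 by case/andP: x01 => ? ?; rewrite !ltW.
have [u10 _] := fs_initial hu xc.
move: r; rewrite /caputo_laplace_rule u10 mulr0 subr0.
rewrite (laplace_itv_oo lc) (laplace_itv_oo l1) => r.
have i1 := laplaceable_itv_oo l1; have i2 := laplaceable_itv_oo l2.
have ic := laplaceable_itv_oo lc.
have [ia ea] := RintegralD_scale (P * (beta * R1)) P mB ic id.
have [ib eb] := RintegralD_scale (P * (omega + lambda)) (- (P * omega)) mB i1 i2.
have [_ e] := RintegralD_scale 1 1 mB ia ib.
(* The four integrable terms are grouped in pairs to match [RintegralD_scale]. *)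
transitivity (\int[leb]_(t in B)
  (1 * (P * (beta * R1) * (expR (- (s * t)) * caputo alpha (u1 x) t)
        + P * (expR (- (s * t)) * dx u1 x t))
   + 1 * (P * (omega + lambda) * (expR (- (s * t)) * u1 x t)
        + - (P * omega) * (expR (- (s * t)) * u2 x t)))).
  apply: eq_Rintegral => t; rewrite inE => /B_gt0 t0.
  have := fs_mobile hu x01 t0; have P0 : P != 0 by rewrite gt_eqF.
  move=> em; have -> : dxx u1 x t = P * (P^-1 * dxx u1 x t) by rewrite mulVKf.
  have -> : P^-1 * dxx u1 x t = beta * R1 * caputo alpha (u1 x) t + dx u1 x t
     + omega * (u1 x t - u2 x t) + lambda * u1 x t by rewrite em; ring.
  ring.
rewrite e ea eb r !mul1r.
have d0 : (1 - beta) * R2 * s `^ gamma + omega + mu != 0.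
  rewrite gt_eqF// addr_gt0// ltr_wpDl// !mulr_ge0 ?powR_ge0//.
    by case/andP: hbeta => _ /ltW; rewrite subr_ge0.
  by apply: le_trans hR2.
have -> : L (u2 x) = omega * L (u1 x) / ((1 - beta) * R2 * s `^ gamma + omega + mu).
  by apply: (mulfI d0); rewrite immobile_transform// [RHS]mulrC divfK.
by rewrite /symbol; field.
Qed.

Let sBc : B `<=` (`[0%R, +oo[%classic : set R).
Proof. by apply: subset_itvr; rewrite bnd_simp. Qed.

(** Stated for a general [h] because it serves first for [u1] and then for [dx u1]. The left end [a]
    keeps away from the inlet, since majorants are only assumed there. *)
Lemma is_derive_transform (h : R -> R -> R) (a : R) :
  (forall x : R, a < x < 1 ->
     leb.-integrable B (EFin \o (fun t => expR (- (s * t)) * h x t))) ->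
  (forall x t : R, a < x < 1 -> 0 < t -> derivable (h ^~ t) x 1) ->
  laplaceable_on `[a, 1[ (dx h) s ->
  forall x : R, a < x < 1 ->
    leb.-integrable B (EFin \o (fun t => expR (- (s * t)) * dx h x t)) /\
    is_derive x 1 (fun y => L (h y)) (L (dx h x)).
Proof.
move=> ih dh [g ig hg] x xa.
have ig' : leb.-integrable B (EFin \o g).
  apply: (integrableS _ mB sBc ig); exact: measurable_itv.
have dE y t : a < y < 1 -> B t ->
    is_derive y 1 (fun z => expR (- (s * t)) * h z t) (expR (- (s * t)) * dx h y t).
  move=> ya /B_gt0 t0; apply: (is_deriveZ (expR (- (s * t))) (f := h ^~ t)).
  by rewrite /dx derive1E; apply/derivableP; exact: dh.
have d1E y t : a < y < 1 -> B t ->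
    derive1 (fun z => expR (- (s * t)) * h z t) y = expR (- (s * t)) * dx h y t.
  by move=> ya Bt; rewrite derive1E; have [_ ->] := dE y t ya Bt.
have [||i d] := @is_derive_Rintegral R _ _ leb B
  (fun z t => expR (- (s * t)) * h z t) g a 1 mB ih _ ig' _ x xa.
- by move=> y t ya Bt; have [] := dE y t ya Bt.
- move=> y t ya Bt; rewrite d1E//; apply: hg; last exact: B_gt0.
  by rewrite /= in_itv/=; case/andP: ya => /ltW -> ->.
split.
  apply: eq_integrable i => // t; rewrite inE => Bt; by rewrite /= d1E.
rewrite (_ : L (dx h x) = \int[leb]_(t in B)
    derive1 (fun z => expR (- (s * t)) * h z t) x)//.
by apply: eq_Rintegral => t; rewrite inE => Bt; rewrite d1E.
Qed.

Lemma transform_is_derive (x : R) : 0 < x < 1 ->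
  is_derive x 1 (fun y => L (u1 y)) (L (dx u1 x)) /\
  is_derive x 1 (fun y => L (dx u1 y)) (P * L (dx u1 x) + P * k * L (u1 x)).
Proof.
(* Differentiability is local, so for each x the majorants on [x/2, 1[ suffice. *)
move=> x01; have a01 : 0 < x / 2 < 1 by lra.
have ax : x / 2 < x < 1 by lra.
have sub y : x / 2 < y < 1 -> 0 < y < 1 by lra.
have [l1 l2] := hdx a01.
have ih1 y : x / 2 < y < 1 ->
    leb.-integrable B (EFin \o (fun t => expR (- (s * t)) * u1 y t)).
  by move=> /sub /hu1[l _ _]; exact: laplaceable_itv_oo.
have dh1 y t : x / 2 < y < 1 -> 0 < t -> derivable (u1 ^~ t) y 1.
  move=> ya t0; have [d _ _] := fs_dx hu t0; apply: d.
  by rewrite in_itv/=; exact: sub.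
have dh2 y t : x / 2 < y < 1 -> 0 < t -> derivable (dx u1 ^~ t) y 1.
  by move=> ya t0; apply: (fs_dxx hu) => //; exact: sub.
have ih2 y : x / 2 < y < 1 ->
    leb.-integrable B (EFin \o (fun t => expR (- (s * t)) * dx u1 y t)).
  by move=> ya; have [] := is_derive_transform ih1 dh1 l1 ya.
split; first by have [] := is_derive_transform ih1 dh1 l1 ax.
rewrite -mobile_transform//; last exact: ih2.
by have [] := is_derive_transform ih2 dh2 l2 ax.
Qed.

(** Boundedness of [u1] gives the majorant M e^(-s t), so the inlet value 1 passes to the transform
    and yields the integral of e^(-s t). *)
Lemma transform_inlet :
  L (u1 (harmonic n.+1)) @[n --> \oo] --> s^-1.
Proof.
have [M uM] := fs_bounded hu.
rewrite -(Rintegral_expR_scale s0).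
have [||||_ ] := @Rintegral_dominated_cvg R _ _ leb B
  (fun n t => expR (- (s * t)) * u1 (harmonic n.+1) t)
  (fun t => expR (- (s * t))) (fun t => M * expR (- (s * t))) mB.
- move=> n; have [l _ _] := hu1 (harmonicS_itv n).
  by have /integrableP[/measurable_EFinP] := laplaceable_itv_oo l.
- move=> t /B_gt0 t0; rewrite -[X in _ --> X]mulr1; apply: cvgM.
    exact: cvg_cst.
  have [_ + _] := fs_dx hu t0; have [-> _] := fs_inlet hu t0.
  move=> /cvg_at_rightP; apply; split; last exact: cvg_harmonicS.
  by move=> n; exact: harmonic_gt0.
- exact: (integrableZl mB M (integrable_expR_scale s0)).
- move=> n t /B_gt0 t0; rewrite normrM ger0_norm ?expR_ge0// mulrC.
  rewrite ler_pM2r ?expR_gt0//; have h01 := @harmonicS_itv R n.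
  have hc : 0 <= (harmonic n.+1 : R) <= 1 by case/andP: h01 => h0 h1; rewrite !ltW.
  by have [] := uM _ _ hc (ltW t0).
- exact.
Qed.

(** The outlet condition makes the difference quotients of [u1] at 1 tend to 0 for each t; the mean
    value theorem bounds them by values of [dx u1], so dominated convergence applies. *)
Lemma transform_outlet :
  (L (u1 1) - L (u1 (1 - harmonic n.+1))) / harmonic n.+1 @[n --> \oo] --> 0.
Proof.
have [M uM] := fs_bounded hu.
pose h n : R := harmonic n.+1.
have h01 n : 0 < h n < 1 by exact: harmonicS_itv.
have hn0 n : h n != 0 by case/andP: (h01 n) => /gt_eqF ->.
have hx n : 0 < 1 - h n < 1 by have := h01 n; lra.
have cvgh : 1 - h n @[n --> \oo] --> (1 : R).
  rewrite -[X in _ --> X]subr0; apply: cvgB; first exact: cvg_cst.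
  exact: cvg_harmonicS.
have in_ n : leb.-integrable B (EFin \o (fun t => expR (- (s * t)) * u1 (1 - h n) t)).
  by have [l _ _] := hu1 (hx n); exact: laplaceable_itv_oo.
have min n : measurable_fun B (fun t => expR (- (s * t)) * u1 (1 - h n) t).
  by have /integrableP[/measurable_EFinP] := in_ n.
(* Transformability is assumed for interior x only; at x = 1 it is obtained here as a dominated
   limit. *)
have [|||i1 _] := @Rintegral_dominated_cvg R _ _ leb B
  (fun n t => expR (- (s * t)) * u1 (1 - h n) t)
  (fun t => expR (- (s * t)) * u1 1 t) (fun t => M * expR (- (s * t))) mB min.
- move=> t /B_gt0 t0; apply: cvgM; first exact: cvg_cst.
  have [_ _ +] := fs_dx hu t0.
  move=> /cvg_at_leftP; apply; split => // n.
  by case/andP: (hx n).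
- exact: (integrableZl mB M (integrable_expR_scale s0)).
- move=> n t /B_gt0 t0; rewrite normrM ger0_norm ?expR_ge0// mulrC.
  rewrite ler_pM2r ?expR_gt0//.
  have hc : 0 <= 1 - h n <= 1 by have := hx n; lra.
  by have [] := uM _ _ hc (ltW t0).
(* [1 - h 0] is 1/2, the leftmost of the points [1 - h n], so one majorant [g] covers all the
   intermediate points. *)
have [g ig hg] := (hdx (hx 0%N)).1.
have ig' : leb.-integrable B (EFin \o g).
  apply: (integrableS _ mB sBc ig); exact: measurable_itv.
pose q n t := (h n)^-1 * (expR (- (s * t)) * u1 1 t)
   + (- (h n)^-1) * (expR (- (s * t)) * u1 (1 - h n) t).
have qE n : \int[leb]_(t in B) q n t = (L (u1 1) - L (u1 (1 - h n))) / h n.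
  have [_ ->] := RintegralD_scale (h n)^-1 (- (h n)^-1) mB i1 (in_ n).
  by ring.
have qE' n t : q n t = expR (- (s * t)) * ((u1 1 t - u1 (1 - h n) t) / h n).
  by rewrite /q; ring.
have [||||_ ] := @Rintegral_dominated_cvg R _ _ leb B q (fun=> 0) g mB.
- move=> n; have [i _] := RintegralD_scale (h n)^-1 (- (h n)^-1) mB i1 (in_ n).
  by have /integrableP[/measurable_EFinP] := i.
- move=> t /B_gt0 t0.
  suff : expR (- (s * t)) * ((u1 1 t - u1 (1 - h n) t) / h n) @[n --> \oo]
      --> expR (- (s * t)) * 0.
    rewrite mulr0; apply: cvg_trans; apply: near_eq_cvg; apply: nearW => n.
    by rewrite qE'.
  apply: cvgM; first exact: cvg_cst.
  have [+ _] := fs_outlet hu t0.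
  move=> /cvg_at_leftP /(_ (fun n => - h n)).
  have Nh n : - h n < 0 by rewrite oppr_lt0; case/andP: (h01 n).
  have cNh : - h n @[n --> \oo] --> 0.
    by rewrite -oppr0; apply: cvgN; exact: cvg_harmonicS.
  move=> /(_ (conj Nh cNh)); apply: cvg_trans; apply: near_eq_cvg.
  by apply: nearW => n; rewrite invrN mulNr -mulrN opprB mulrC.
- exact: ig'.
- move=> n t /B_gt0 t0; rewrite qE'.
  have hmono : 1 - h 0%N <= 1 - h n.
    by rewrite lerD2l lerN2 /h /= lef_pV2 ?posrE ?ltr0n// ler_nat.
  have h_gt0 : 0 < h n by case/andP: (h01 n).
  have h_lt : 1 - h n < 1 by rewrite ltrBlDr ltrDl.
  have sub y : y \in `]1 - h n, 1[%R -> 0 < y < 1.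
    by rewrite in_itv/=; have := hx n; lra.
  have [dh c0 c1] := fs_dx hu t0.
  have du y : y \in `]1 - h n, 1[%R -> is_derive y 1 (u1 ^~ t) (dx u1 y t).
    move=> ya; rewrite /dx derive1E; apply/derivableP; apply: dh.
    by rewrite in_itv/=; exact: sub.
  have cu : {within `[1 - h n, 1], continuous (u1 ^~ t)}.
    apply: continuous_subspaceW (derivable_oo_LRcontinuous_within (fs_dx hu t0)).
    by apply: subset_itvr; rewrite bnd_simp; case/andP: (hx n) => /ltW.
  (* The quotient equals [dx u1] at some c in ]1 - h n, 1[. *)
  have [c cI ->] := MVT h_lt du cu.
  rewrite opprB addrC subrK mulfK//; apply: hg => //.
  move: cI; rewrite /= !in_itv/= => /andP[/ltW cl ->].
  by rewrite (le_trans hmono).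
- rewrite Rintegral_cst// mul0r; apply: cvg_trans; apply: near_eq_cvg.
  by apply: nearW => n; rewrite qE.
Qed.

(** [p] and [m] are the roots of r^2 - P r - P k, the characteristic polynomial of the transformed
    equation, whose boundary data are 1/s at 0 and slope 0 at 1. *)
Lemma transform_eq_profile (p m : R) : 0 < p -> m < 0 -> p + m = P ->
  p * m = - (P * k) ->
  forall x : R, 0 < x < 1 ->
    laplace (u1 x) s = s^-1 * (profile p m x / profile p m 0).
Proof.
move=> p0 m0 pmP pmk x x01; have [l1 _ _] := hu1 x01.
rewrite laplace_itv_oo//.
apply: (@boundary_value_problem_solution R p m s^-1 (L (u1 1)) (fun y => L (u1 y))
  (fun y => L (dx u1 y)) (fun n => harmonic n.+1)) => //.
- by move=> y y01; have [] := transform_is_derive y01.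
- move=> y y01; rewrite pmP pmk mulNr opprK.
  by have [] := transform_is_derive y01.
- exact: harmonicS_itv.
- exact: cvg_harmonicS.
- exact: transform_inlet.
- exact: transform_outlet.
Qed.

End transformed_solution.

(** * Recovering the two orders from the symbol *)

Section symbol_orders.
Context {R : realType}.
Variables (beta R1 R2 omega lambda mu : R).
Hypotheses (hbeta : 0 < beta < 1) (hR1 : 1 <= R1) (hR2 : 1 <= R2).
Hypotheses (homega : 0 < omega) (hlambda : 0 < lambda) (hmu : 0 < mu).
Local Notation sym := (symbol beta R1 R2 omega lambda mu).
Local Notation den gamma s := ((1 - beta) * R2 * s `^ gamma + omega + mu).

Let c1 : 0 < beta * R1.
Proof. by case/andP: hbeta => b0 _; rewrite mulr_gt0// (lt_le_trans _ hR1). Qed.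

Let c2 : 0 < (1 - beta) * R2.
Proof.
by case/andP: hbeta => _ b1; rewrite mulr_gt0 ?subr_gt0// (lt_le_trans _ hR2).
Qed.

Let den_gt gamma (s : R) : omega < den gamma s.
Proof.
have : 0 <= (1 - beta) * R2 * s `^ gamma by rewrite mulr_ge0 ?powR_ge0// ltW.
by move=> h0; rewrite -addrA ltr_wpDl// ltrDl.
Qed.

(** The denominator exceeds [omega], which bounds the term uniformly in s. *)
Lemma immobile_term_itv gamma (s : R) :
  0 < omega ^+ 2 / den gamma s < omega.
Proof.
have d0 := lt_trans homega (den_gt gamma s).
rewrite divr_gt0 ?exprn_gt0//= ltr_pdivrMr// expr2 ltr_pM2l//.
Qed.

(** The summand [omega] outweighs the immobile term. Positivity is what gives the characteristic
    roots opposite signs. *)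
Lemma symbol_gt0 alpha gamma (s : R) : 0 < sym alpha gamma s.
Proof.
have /andP[_ lt_omega] := immobile_term_itv gamma s.
rewrite subr_gt0 (lt_trans lt_omega)// -addrA ltr_wpDl ?ltrDl//.
by rewrite mulr_ge0 ?powR_ge0// ltW.
Qed.

(* The immobile term of the symbol stays in (0, omega), so equal symbols force
   s^a2 - s^a1 = s^a1 (s^(a2 - a1) - 1) to stay bounded. *)
Lemma mobile_order_le (a1 g1 a2 g2 : R) : 0 < a1 ->
  (\forall s \near +oo, sym a1 g1 s = sym a2 g2 s) -> a2 <= a1.
Proof.
move=> a10 [M [_ eqs]]; rewrite leNgt; apply/negP => a12.
have d0 : 0 < a2 - a1 by rewrite subr_gt0.
(* [C] is chosen so that [beta * R1 * (C - 1)] equals [omega]. *)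
pose C := 1 + omega / (beta * R1).
have C1 : 1 < C by rewrite /C ltrDl divr_gt0.
(* Beyond the threshold [M], and large enough that s^(a2 - a1) is at least [C]. *)
pose s := Num.max (M + 1) (C `^ (a2 - a1)^-1).
have Ms : M < s by rewrite lt_max ltrDl ltr01.
have Cs : C `^ (a2 - a1)^-1 <= s by rewrite le_max lexx orbT.
have C0 : 0 < C by exact: lt_trans C1.
have s1 : 1 <= s.
  by rewrite (le_trans _ Cs)// -(powRr0 C) ler_powR ?(ltW C1)// invr_ge0 ltW.
have s0 : 0 < s by exact: lt_le_trans s1.
have CsD : C <= s `^ (a2 - a1).
  rewrite -[leLHS](powRr1 (ltW C0)) -(mulVf (lt0r_neq0 d0)) powRrM.
  by apply: ge0_ler_powR; rewrite ?nnegrE ?powR_ge0// ltW.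
have sa1 : 1 <= s `^ a1 by rewrite -(powRr0 s) ler_powR// ltW.
have e2 : s `^ a2 = s `^ a1 * s `^ (a2 - a1).
  by rewrite -powRD ?subrKC// (gt_eqF s0) implybT.
have := eqs s Ms; rewrite /symbol e2.
have := immobile_term_itv g1 s; have := immobile_term_itv g2 s.
set x := omega ^+ 2 / _; set y := omega ^+ 2 / _ => /andP[x0 x1] /andP[y0 y1] e.
have oC : omega = beta * R1 * (C - 1).
  by rewrite /C addrC addKr mulrC divfK// gt_eqF.
have : beta * R1 * (C - 1) <= beta * R1 * (s `^ a1 * (s `^ (a2 - a1) - 1)).
  rewrite ler_pM2l// -[leLHS]mul1r ler_pM ?subr_ge0 ?lerD2r ?ler01//.
  exact: ltW.
(* Equal symbols make beta R1 (s^a2 - s^a1) a difference of two numbers in (0, omega), hence less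
   than [omega]: a contradiction. *)
rewrite -oC; nra.
Qed.

(** [mobile_order_le] in both directions identifies the mobile orders. The immobile terms then
    agree, and a single s > 1 determines the exponent of s^gamma. *)
Lemma symbol_orders_inj (a1 g1 a2 g2 : R) : 0 < a1 -> 0 < a2 ->
  (\forall s \near +oo, sym a1 g1 s = sym a2 g2 s) -> a1 = a2 /\ g1 = g2.
Proof.
move=> a10 a20 eqs.
have a12 : a1 = a2.
  apply: le_anti; rewrite (mobile_order_le a10 eqs) andbT.
  by apply: (@mobile_order_le a2 g2 a1 g1) => //; apply: filterS eqs.
split=> //; subst a2.
(* The bound 2 makes ln s nonzero, so that it can be cancelled. *)
case: eqs => M [_ eqs]; pose s := Num.max (M + 1) 2.
have Ms : M < s by rewrite lt_max ltrDl ltr01.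
have s1 : 1 < s by rewrite lt_max ltr1n orbT.
have s0 : 0 < s by exact: lt_trans s1.
have /addrI/oppr_inj := eqs s Ms.
have o20 : omega ^+ 2 != 0 by rewrite expf_neq0// gt_eqF.
move=> /(mulfI o20)/invr_inj/addIr/addIr/(mulfI (lt0r_neq0 c2)).
move=> /(congr1 (@ln R)); rewrite !ln_powR; apply: mulIf.
by rewrite gt_eqF// ln_gt0.
Qed.

End symbol_orders.

(** * Comparison of two solutions with the same observation *)

Theorem theorem4p1 (R : realType) (beta R1 R2 P omega lambda mu : R)
    (hbeta : 0 < beta < 1) (hR1 : 1 <= R1) (hR2 : 1 <= R2) (hP : 0 < P)
    (homega : 0 < omega) (hlambda : 0 < lambda) (hmu : 0 < mu)
    (alpha1 gamma1 alpha2 gamma2 : R)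
    (halpha1 : 0 < alpha1 < 1) (hgamma1 : 0 < gamma1 < 1)
    (halpha2 : 0 < alpha2 < 1) (hgamma2 : 0 < gamma2 < 1)
    (u1 u2 v1 v2 : R -> R -> R)
    (hu : forward_solution beta R1 R2 P omega lambda mu alpha1 gamma1 u1 u2)
    (hv : forward_solution beta R1 R2 P omega lambda mu alpha2 gamma2 v1 v2)
    (x0 : R) (hx0 : 0 < x0 < 1)
    (huv : forall t, 0 < t -> u1 x0 t = v1 x0 t) :
  alpha1 = alpha2 /\ gamma1 = gamma2.
Proof.
have [a10 _] := andP halpha1; have [a20 _] := andP halpha2.
apply: (symbol_orders_inj (lambda := lambda) hbeta hR1 hR2 homega hmu a10 a20).
have [M1 [_ hM1]] := fs_laplace hu; have [M2 [_ hM2]] := fs_laplace hv.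
(* Beyond this threshold s is positive and both solutions can be transformed. *)
exists (Num.max 0 (Num.max M1 M2)); split; first exact: num_real.
move=> s; rewrite !gt_max => /and3P[s0 /hM1[hu1 [hu2 hdu]] /hM2[hv1 [hv2 hdv]]].
set k1 := LHS; set k2 := RHS.
have Pk1 : 0 < P * k1 by rewrite mulr_gt0// symbol_gt0.
have Pk2 : 0 < P * k2 by rewrite mulr_gt0// symbol_gt0.
have [p1 [m1 [p10 m10 pm1 e1]]] := quadratic_roots hP Pk1.
have [p2 [m2 [p20 m20 pm2 e2]]] := quadratic_roots hP Pk2.
have Lu := transform_eq_profile hbeta hR2 hP homega hmu s0 hu hu1 hu2 hdu
  p10 m10 pm1 e1 hx0.
have Lv := transform_eq_profile hbeta hR2 hP homega hmu s0 hv hv1 hv2 hdv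
  p20 m20 pm2 e2 hx0.
have Luv : laplace (u1 x0) s = laplace (v1 x0) s.
  (* The observations agree by assumption for t > 0; at t = 0 both vanish by the initial
     condition. *)
  apply: eq_Rintegral => t; rewrite inE/= in_itv/= andbT le_eqVlt => /predU1P[<-|t0].
    have xc : 0 <= x0 <= 1 by case/andP: hx0 => ? ?; rewrite !ltW.
    by have [-> _] := fs_initial hu xc; have [-> _] := fs_initial hv xc.
  by rewrite huv.
have is0 : s^-1 != 0 by rewrite invr_eq0 gt_eqF.
move: Luv; rewrite Lu Lv => /(mulfI is0) ratioE.
have pmE : p1 + m1 = p2 + m2 by rewrite pm1.
(* The products of roots are - P k1 and - P k2, so a strict inequality between the symbols would
   make the equal ratios at [x0] strictly ordered. *)
have [k12|k21|//] := ltgtP k1 k2.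
- have := profile_ratio_lt p10 m10 p20 m20 pmE _ hx0.
  by rewrite ratioE ltxx e1 e2 ltrN2 ltr_pM2l// => /(_ k12).
- have := profile_ratio_lt p20 m20 p10 m10 (esym pmE) _ hx0.
  by rewrite ratioE ltxx e1 e2 ltrN2 ltr_pM2l// => /(_ k21).
Qed.
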